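(* Let $G$ be a countable infinite discrete group acting by homeomorphisms on a compact Hausdorff space $X$. The following are equivalent: (1) For every closed nonzero ideal $I$ of $\ell^1(G\curvearrowright X)$, the intersection $I\cap C(X)$ is nonzero. (2) For every closed and self-adjoint nonzero ideal $I$ of $\ell^1(G\curvearrowright X)$, the intersection $I\cap C(X)$ is nonzero. (3) The action $G\curvearrowright X$ is topologically free.
   Context: Write $\sigma_s:X\to X$ for the homeomorphism given by $s\in G$, $e$ for the identity of $G$, and $C(X)$ for the continuous functions $X\to\mathbb{C}$ with the supremum norm $\|\cdot\|_\infty$. Set $\alpha_s(f)(x)=f(\sigma_s^{-1}(x))$ for $s\in G$, $f\in C(X)$, $x\in X$. $\ell^1(G\curvearrowright X)$ is the Banach $*$-algebra of all functions $f:G\to C(X)$ with $\|f\|=\sum_{s\in G}\|f(s)\|_\infty<\infty$, with pointwise linear operations, product $(fg)(s)=\sum_{t\in G}f(t)\,\alpha_t(g(t^{-1}s))$ and involution $(f^* )(s)=\alpha_s(\overline{f(s^{-1})})$. $C(X)$ is identified with the subalgebra of those $f\in\ell^1(G\curvearrowright X)$ supported on $\{e\}$. ''Ideal'' means two-sided ideal. An ideal $I$ is self-adjoint if $f^*\in I$ for every $f\in I$. The action is topologically free if the set $\{x\in X:\sigma_s(x)\neq x\text{ for all }s\in G\setminus\{e\}\}$ is dense in $X$. *)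

(* Defs.v *)
From HB Require Import structures.
From mathcomp Require Import all_boot all_order all_algebra.
From mathcomp Require Import finmap complex.
From mathcomp Require Import all_classical all_reals all_analysis ring.
Set Implicit Arguments.
Unset Strict Implicit.
Unset Printing Implicit Defensive.
Import Order.TTheory GRing.Theory Num.Theory numFieldNormedType.Exports.
Local Open Scope classical_set_scope.
Local Open Scope ring_scope.
Local Open Scope complex_scope.
Import ComplexField.Normc.

(* Every [s] acts as a homeomorphism, with inverse the action of [s^-1]. *)
Record action (G : groupType) (X : topologicalType) := Action {
  act :> G -> X -> X;
  act1 : forall x, act 1%g x = x;
  actM : forall s t x, act (s * t)%g x = act s (act t x);
  act_continuous : forall s, continuous (act s) }.

Definition topologically_free (G : groupType) (X : topologicalType)
    (sigma : action G X) :=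
  dense [set x : X | forall s : G, s <> 1%g -> sigma s x <> x].

(* The finite subsets of [I], directed by inclusion. *)
Definition finsets (I : choiceType) : set_system {fset I} :=
  filter_from [set: {fset I}] (fun A => [set B | (A `<=` B)%fset]).

Global Instance finsets_proper (I : choiceType) : ProperFilter (@finsets I).
Proof.
apply: filter_from_proper; last by move=> A _; exists A => /=.
apply: filter_from_filter; first by exists fset0.
move=> A B _ _; exists (A `|` B)%fset => // C /=.
by rewrite fsubUset => /andP[].
Qed.

Definition fsum (V : nmodType) (I : choiceType) (a : I -> V) (F : {fset I}) : V :=
  \sum_(t <- F) a t.

(* Unordered sum. [R[i]^o] is [R[i]] with the topology of its modulus. *)
Definition csum (R : realType) (I : choiceType) (a : I -> R[i]) : R[i]^o :=
  lim ((fsum a : {fset I} -> R[i]^o) @ @finsets I).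

(* The added [0] makes the supremum [0] when [X] is empty. *)
Definition supnorm (R : realType) (X : Type) (f : X -> R[i]) : \bar R :=
  ereal_sup (0%E |` [set (normc (f x))%:E | x in [set: X]]).

Section supnorm.
Context (R : realType) (X : Type).
Implicit Types f g : X -> R[i].
Local Open Scope ereal_scope.

Lemma normc_ge0 (z : R[i]) : (0 <= normc z)%R.
Proof. by case: z => a b; rewrite /normc sqrtr_ge0. Qed.

Lemma normcJ (z : R[i]) : normc z^*%C = normc z.
Proof. by case: z => a b /=; rewrite sqrrN. Qed.

Lemma supnorm_ge0 f : 0 <= supnorm f.
Proof. by apply: ereal_sup_ubound; left. Qed.

Lemma le_supnorm f x : (normc (f x))%:E <= supnorm f.
Proof. by apply: ereal_sup_ubound; right; exists x. Qed.

Lemma supnorm_le f M : 0 <= M -> (forall x, (normc (f x))%:E <= M) ->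
  supnorm f <= M.
Proof. by move=> M0 fM; apply: ge_ereal_sup => _ [->//|[x _ <-]]. Qed.

Lemma supnorm0 : supnorm (0%R : X -> R[i]) = 0.
Proof.
apply/eqP; rewrite eq_le supnorm_ge0 andbT.
by apply: supnorm_le => // x; rewrite normc0.
Qed.

Lemma supnormD f g : supnorm (f + g)%R <= supnorm f + supnorm g.
Proof.
apply: supnorm_le => [|x]; first by rewrite adde_ge0 ?supnorm_ge0.
apply: (@le_trans _ _ (normc (f x) + normc (g x))%R%:E).
  by rewrite lee_fin; exact: le_normcD.
by rewrite EFinD leeD ?le_supnorm.
Qed.

Lemma supnormZ_le (c : R[i]) f :
  supnorm (c *: f)%R <= (normc c)%:E * supnorm f.
Proof.
apply: supnorm_le => [|x].
  by rewrite mule_ge0 ?supnorm_ge0 ?lee_fin ?normc_ge0.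
by rewrite /= normcM EFinM lee_wpmul2l ?lee_fin ?normc_ge0 ?le_supnorm.
Qed.

Lemma supnormZ (c : R[i]) f : supnorm (c *: f)%R = (normc c)%:E * supnorm f.
Proof.
apply/eqP; rewrite eq_le supnormZ_le /=.
have [->|c0] := eqVneq c 0%R.
  by rewrite normc0 mul0e supnorm_ge0.
have nc0 : (0 < normc c)%R.
  rewrite lt_neqAle normc_ge0 andbT eq_sym.
  by apply: contraNN c0 => /eqP/eq0_normc ->.
rewrite -[X in supnorm X](scalerK c0 f).
apply: (le_trans (lee_wpmul2l _ (supnormZ_le _ _))).
  by rewrite lee_fin normc_ge0.
by rewrite muleA -EFinM -normcM divff// normc1 mul1e.
Qed.

Lemma supnormM f g : supnorm (fun x => f x * g x)%R <= supnorm f * supnorm g.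
Proof.
apply: supnorm_le => [|x]; first by rewrite mule_ge0 ?supnorm_ge0.
by rewrite normcM EFinM lee_pmul ?lee_fin ?normc_ge0 ?le_supnorm.
Qed.

Lemma supnormJ f : supnorm (fun x => (f x)^*%C) = supnorm f.
Proof.
by congr (ereal_sup (_ |` _)); apply: eq_imagel => x _; rewrite normcJ.
Qed.

Lemma supnorm_eq0 f : supnorm f = 0 -> f = 0%R.
Proof.
move=> f0; apply/funext => x; apply: eq0_normc; apply/eqP.
by rewrite eq_le normc_ge0 andbT -lee_fin (le_trans (le_supnorm f x))// f0.
Qed.

End supnorm.

Lemma supnorm_comp (R : realType) (X Y : Type) (f : X -> R[i]) (h : Y -> X) :
  (supnorm (f \o h) <= supnorm f)%E.
Proof.
by apply: supnorm_le => [|y]; [exact: supnorm_ge0|exact: le_supnorm].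
Qed.

Lemma esumZl_le (R : realType) (I : choiceType) (c : R) (b : I -> \bar R) :
  (0 <= c)%R -> (forall t, 0 <= b t)%E ->
  (\esum_(t in [set: I]) (c%:E * b t) <= c%:E * \esum_(t in [set: I]) b t)%E.
Proof.
move=> c0 b0; apply: ge_ereal_sup => _ [A [Afin _] <-].
rewrite fsbig_finite//= -ge0_sume_distrr// lee_wpmul2l//.
by apply: esum_ge; exists A => //; rewrite fsbig_finite.
Qed.

Lemma esumZl (R : realType) (I : choiceType) (c : R) (b : I -> \bar R) :
  (0 <= c)%R -> (forall t, 0 <= b t)%E ->
  (\esum_(t in [set: I]) (c%:E * b t) = c%:E * \esum_(t in [set: I]) b t)%E.
Proof.
move=> c0 b0; apply/eqP; rewrite eq_le esumZl_le//=.
have [<-|cN0] := eqVneq 0 c; last have {}c0 : 0 < c by rewrite lt_def eq_sym cN0.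
  by rewrite mul0e esum_ge0// => t _; rewrite mul0e.
have cb0 t : (0 <= c%:E * b t)%E by rewrite mule_ge0// lee_fin ltW.
rewrite [X in (_ * X)%E](_ : _ =
    \esum_(t in [set: I]) (c^-1%:E * (c%:E * b t)))%E; last first.
  by apply: eq_esum => t _; rewrite muleA -EFinM mulVf ?gt_eqF// mul1e.
have ci0 : 0 <= c^-1 by rewrite invr_ge0 ltW.
apply: le_trans (lee_wpmul2l _ (esumZl_le ci0 cb0)) _; first by rewrite lee_fin ltW.
by rewrite muleA -EFinM divff ?gt_eqF// mul1e.
Qed.

Section csum.
Context (R : realType) (I : choiceType).
Implicit Types (a : I -> R[i]) (F : {fset I}).

Lemma esum_fset_le (b : I -> \bar R) F : (forall t, 0 <= b t)%E ->
  (\sum_(t <- F) b t <= \esum_(t in [set: I]) b t)%E.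
Proof.
move=> b0; apply: esum_ge; exists [set` F]; first by split.
by rewrite fsbig_finite//= set_fsetK.
Qed.

Lemma esum_tail_fset (b : I -> \bar R) F F' : (forall t, 0 <= b t)%E ->
  (F `<=` F')%fset ->
  (\sum_(t <- (F' `\` F)%fset) b t <= \esum_(t in ~` [set` F]) b t)%E.
Proof.
move=> b0 FF'; apply: esum_ge; exists [set` (F' `\` F)%fset].
  by split=> // t; rewrite /= inE => /andP[/negP].
by rewrite fsbig_finite//= set_fsetK.
Qed.

Lemma esum_small_tail (b : I -> \bar R) (e : R) : (forall t, 0 <= b t)%E ->
  (\esum_(t in [set: I]) b t < +oo)%E -> 0 < e ->
  exists F, (\esum_(t in ~` [set` F]) b t < e%:E)%E.
Proof.
move=> b0 boo e0.
have bfin : (\esum_(t in [set: I]) b t)%E \is a fin_num.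
  by rewrite ge0_fin_numE// esum_ge0.
have [_ [A [Afin _] <-]] := ub_ereal_sup_adherent e0 bfin.
rewrite -/(esum _ _) => HA; exists (fset_set A); rewrite fset_setK//.
move: HA bfin; rewrite (esumID A)// setTI setTI.
rewrite esum_fset//.
rewrite fin_numD => + /andP[sA sB].
case: (bigop.body _ _ _) sA => [x| |] // _; case: (esum _ _) sB => [y| |] // _.
change ((x + y - e)%:E < x%:E -> y%:E < e%:E)%E.
by rewrite !lte_fin -addrA gtrDl subr_lt0.
Qed.

Lemma big_fset_split (V : zmodType) (a : I -> V) F F' : (F `<=` F')%fset ->
  \sum_(t <- F') a t - \sum_(t <- F) a t = \sum_(t <- (F' `\` F)%fset) a t.
Proof.
move=> FF'; suff -> : \sum_(t <- F') a t =
    \sum_(t <- F ++ (F' `\` F)%fset) a t by rewrite big_cat/= addrAC subrr add0r.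
apply: perm_big; apply: uniq_perm; first exact: fset_uniq.
  rewrite cat_uniq !fset_uniq/= andbT; apply/hasPn => t.
  by rewrite inE => /andP[].
move=> t; rewrite mem_cat inE.
by have [/(fsubsetP FF')->|] := boolP (t \in F).
Qed.

Lemma normc_sum a F :
  ((normc (\sum_(t <- F) a t))%:E <= \sum_(t <- F) (normc (a t))%:E)%E.
Proof.
rewrite sumEFin lee_fin; elim/big_ind2 : _ => [|x x' y y' xx' yy'|//].
  by rewrite normc0.
by rewrite (le_trans (le_normcD _ _)) ?lerD.
Qed.

Lemma normc_fset_tail a F F' : (F `<=` F')%fset ->
  ((normc (\sum_(t <- F') a t - \sum_(t <- F) a t))%:E <=
   \esum_(t in ~` [set` F]) (normc (a t))%:E)%E.
Proof.
move=> FF'; rewrite big_fset_split//; apply: (le_trans (normc_sum _ _)).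
by apply: esum_tail_fset => // t; rewrite lee_fin normc_ge0.
Qed.

Lemma near_finsets F : \forall F' \near @finsets I, (F `<=` F')%fset.
Proof. by exists F. Qed.

Lemma rsum_cvg (r : I -> R) : (\esum_(t in [set: I]) `|r t|%:E < +oo)%E ->
  cvg (fsum r @ @finsets I).
Proof.
move=> roo; apply/cauchy_cvgP/cauchy_exP => e e0.
have r0 t : (0 <= `|r t|%:E)%E by rewrite lee_fin.
have [F Fe] := esum_small_tail r0 roo e0.
exists (fsum r F); exists F => // F' FF' /=.
rewrite /ball/= distrC /fsum big_fset_split// -lte_fin; apply: le_lt_trans Fe.
apply: le_trans (esum_tail_fset r0 FF').
by rewrite sumEFin lee_fin ler_norm_sum.
Qed.

Lemma normc_Re (z : R[i]) : `|complex.Re z| <= normc z.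
Proof. by rewrite -lecR; exact: normc_ge_Re. Qed.

Lemma normc_Im (z : R[i]) : `|complex.Im z| <= normc z.
Proof.
by case: z => x y /=; rewrite -sqrtr_sqr ler_wsqrtr// lerDr sqr_ge0.
Qed.

Lemma normc_le_ReIm (z : R[i]) : normc z <= `|complex.Re z| + `|complex.Im z|.
Proof.
case: z => x y /=; rewrite -[leRHS]ger0_norm ?addr_ge0// -sqrtr_sqr ler_wsqrtr//.
by rewrite sqrrD !real_normK ?num_real// lerD2r lerDl mulrn_wge0 ?mulr_ge0.
Qed.

Lemma cvgcP (T : Type) (F : set_system T) (FF : Filter F) (f : T -> R[i])
    (l : R[i]) :
  (f : T -> R[i]^o) @ F --> (l : R[i]^o) <->
  (forall e : R, 0 < e -> \forall t \near F, normc (l - f t) < e).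
Proof.
split=> [/cvgrPdist_lt fl e e0|fl].
  have := fl e%:C; rewrite ltcR => /(_ e0).
  by apply: filterS => t; rewrite /Num.norm/= ltcR.
apply/cvgrPdist_lt => -[e e'] /=; rewrite ltcE/= => /andP[/eqP-> e0].
apply: filterS (fl _ e0) => t.
by rewrite -ltcR.
Qed.

Lemma csum_cvgP a : (\esum_(t in [set: I]) (normc (a t))%:E < +oo)%E ->
  forall e : R, 0 < e ->
  \forall F \near @finsets I, normc (csum a - fsum a F) < e.
Proof.
move=> aoo; apply/cvgcP.
have cre : cvg (fsum (fun t => complex.Re (a t)) @ @finsets I).
  apply: rsum_cvg; apply: le_lt_trans aoo; apply: le_esum => t _.
  by rewrite lee_fin normc_Re.
have cim : cvg (fsum (fun t => complex.Im (a t)) @ @finsets I).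
  apply: rsum_cvg; apply: le_lt_trans aoo; apply: le_esum => t _.
  by rewrite lee_fin normc_Im.
apply: (cvgP (((lim (fsum (fun t => complex.Re (a t)) @ @finsets I)) +i*
  (lim (fsum (fun t => complex.Im (a t)) @ @finsets I))) : R[i]^o)).
apply/cvgcP => e e0.
have e20 : 0 < e / 2 by rewrite divr_gt0.
near=> F; apply: (le_lt_trans (normc_le_ReIm _)); rewrite [e]splitr.
rewrite !raddfB/= [complex.Re (fsum _ _)]raddf_sum.
rewrite [complex.Im (fsum _ _)]raddf_sum ltrD//.
- by near: F; move/cvgrPdist_lt : cre; exact.
- by near: F; move/cvgrPdist_lt : cim; exact.
Unshelve. all: by end_near. Qed.

Lemma csum_tail a F : (\esum_(t in [set: I]) (normc (a t))%:E < +oo)%E ->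
  ((normc (csum a - \sum_(t <- F) a t))%:E <=
   \esum_(t in ~` [set` F]) (normc (a t))%:E)%E.
Proof.
move=> aoo; apply/lee_addgt0Pr => e e0.
have [F' [F'e FF']] : exists F', normc (csum a - \sum_(t <- F') a t) < e /\
    (F `<=` F')%fset.
  apply: (@filter_ex _ (@finsets I)); apply: filterI (near_finsets _).
  exact: csum_cvgP.
have := le_normcD (csum a - \sum_(t <- F') a t)
  (\sum_(t <- F') a t - \sum_(t <- F) a t).
rewrite addrA subrK -lee_fin EFinD addeC => /le_trans; apply.
by rewrite leeD ?normc_fset_tail// lee_fin ltW.
Qed.

Lemma normc_csum a : (\esum_(t in [set: I]) (normc (a t))%:E < +oo)%E ->
  ((normc (csum a))%:E <= \esum_(t in [set: I]) (normc (a t))%:E)%E.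
Proof.
move/(@csum_tail _ fset0); rewrite big_nil subr0 => /le_trans; apply.
by rewrite (_ : ~` _ = setT)// -subTset => t _ /=; rewrite inE.
Qed.

End csum.

(* alpha_s(f) = f \o sigma_s^{-1}. *)
Definition translate (R : realType) (G : groupType) (X : topologicalType)
    (sigma : action G X) (s : G) (f : X -> R[i]) : X -> R[i] :=
  fun x => f (sigma s^-1%g x).

Section l1.
Context (R : realType) (G : groupType) (X : topologicalType).

(* Summability forces each [f s] to be bounded, which is no restriction when [X]
   is compact. *)
Definition l1_pred : {pred G -> X -> R[i]} := fun f =>
  `[< (forall s, continuous (f s : X -> R[i]^o)) /\
      (\esum_(s in [set: G]) supnorm (f s) < +oo)%E >].

Lemma l1_submod_closed : GRing.submod_closed l1_pred.
Proof.
split=> [|c f g /asboolP[fc foo] /asboolP[gc goo]]; apply/asboolP; split.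
- by move=> s; exact: cst_continuous.
- by rewrite esum1// => s _; exact: supnorm0.
- by move=> s x; apply: cvgD (gc s x); apply: cvgM (fc s x); exact: cvg_cst.
- apply: (@le_lt_trans _ _ ((normc c)%:E * (\esum_(s in [set: G]) supnorm (f s)) +
    \esum_(s in [set: G]) supnorm (g s))%E).
    have <- : (\esum_(s in [set: G]) ((normc c)%:E * supnorm (f s)) =
        (normc c)%:E * \esum_(s in [set: G]) supnorm (f s))%E.
      by apply: esumZl => [|s]; [exact: normc_ge0|exact: supnorm_ge0].
    rewrite -esumD => [|s _|s _]; last 2 first.
    + by rewrite mule_ge0 ?supnorm_ge0// lee_fin normc_ge0.
    + exact: supnorm_ge0.
    apply: le_esum => s _; rewrite -supnormZ; exact: supnormD.
  by rewrite lte_add_pinfty// lte_mul_pinfty// lee_fin normc_ge0.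
Qed.

HB.instance Definition _ := GRing.isSubmodClosed.Build R[i] (G -> X -> R[i])
  l1_pred l1_submod_closed.

Record l1 := L1 { l1_val :> G -> X -> R[i]; l1_valP : l1_val \in l1_pred }.

HB.instance Definition _ := [isSub for l1_val].
HB.instance Definition _ := [Choice of l1 by <:].
HB.instance Definition _ := [SubChoice_isSubLmodule of l1 by <:].

Lemma l1_continuous (f : l1) s : continuous (f s : X -> R[i]^o).
Proof. by have /asboolP[] := l1_valP f. Qed.

Lemma l1_summable (f : l1) : (\esum_(s in [set: G]) supnorm (f s) < +oo)%E.
Proof. by have /asboolP[] := l1_valP f. Qed.

Definition l1_norm (f : l1) : R := fine (\esum_(s in [set: G]) supnorm (f s)).

Lemma l1_normE (f : l1) :
  ((l1_norm f)%:E = \esum_(s in [set: G]) supnorm (f s))%E.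
Proof.
rewrite fineK// ge0_fin_numE ?l1_summable//.
by apply: esum_ge0 => s _; exact: supnorm_ge0.
Qed.

Lemma l1_ler_normD (f g : l1) :
  (l1_norm (f + g))%:C <= (l1_norm f)%:C + (l1_norm g)%:C.
Proof.
rewrite -rmorphD lecR -lee_fin EFinD !l1_normE -esumD => [|s _|s _].
- by apply: le_esum => s _; exact: supnormD.
- exact: supnorm_ge0.
- exact: supnorm_ge0.
Qed.

Lemma l1_normrZ (c : R[i]) (f : l1) :
  (l1_norm (c *: f))%:C = `|c| * (l1_norm f)%:C.
Proof.
rewrite [X in X * _](_ : _ = (normc c)%:C)// -rmorphM; congr (_%:C).
apply/EFin_inj; rewrite EFinM !l1_normE -esumZl ?normc_ge0//.
  by apply: eq_esum => s _; rewrite -supnormZ.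
by move=> s; exact: supnorm_ge0.
Qed.

Lemma l1_normr0_eq0 (f : l1) : (l1_norm f)%:C = 0 -> f = 0.
Proof.
move=> [f0]; apply/val_inj/funext => s; apply: supnorm_eq0.
apply/eqP; rewrite eq_le supnorm_ge0 andbT -[leRHS]/(0%:E) -f0 l1_normE.
apply: esum_ge; exists [set s]; first by split.
by rewrite fsbig_set1.
Qed.

HB.instance Definition _ :=
  Lmodule_isNormed.Build R[i] l1 l1_ler_normD l1_normrZ l1_normr0_eq0.

Context (sigma : action G X).

(* For [f g : l1] the series also converges in the supremum norm, so its sum in
   C(X) is computed pointwise. *)
Definition conv (f g : G -> X -> R[i]) : G -> X -> R[i] := fun s x =>
  csum (fun t => f t x * translate sigma t (g (t^-1 * s)%g) x).

Lemma esum_supnorm_conv (f g : l1) :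
  (\esum_(s in [set: G]) \esum_(t in [set: G])
     (supnorm (f t) * supnorm (g (t^-1 * s)%g)) < +oo)%E.
Proof.
have N0 (h : l1) t : (0 <= supnorm (h t))%E by exact: supnorm_ge0.
have fg0 s t : (0 <= supnorm (f t) * supnorm (g (t^-1 * s)%g))%E.
  by rewrite mule_ge0.
rewrite esum_esum//.
rewrite (reindex_esum ([set: G] `*`` (fun=> [set: G])) _
  (fun x => (x.2, x.1)))/=; last first.
  split=> //; first by move=> [x1 x2] [y1 y2] _ _ [-> ->].
  by move=> [x y] _; exists (y, x).
rewrite -(@esum_esum _ _ _ _ (fun=> setT)
  (fun t s => supnorm (f t) * supnorm (g (t^-1 * s)%g)))%E//.
have ffin t : supnorm (f t) \is a fin_num.
  rewrite ge0_fin_numE//; apply: le_lt_trans (l1_summable f).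
  apply: esum_ge; exists [set t]; first by split.
  by rewrite fsbig_set1.
rewrite (eq_esum (b := fun t => (l1_norm g)%:E * supnorm (f t))%E).
  rewrite esumZl//; last by rewrite -lee_fin l1_normE esum_ge0.
  by rewrite -l1_normE -EFinM ltry.
move=> t _; rewrite -(fineK (ffin t)) esumZl//; last exact: fine_ge0.
rewrite muleC l1_normE; congr (_ * _)%E.
rewrite [RHS](reindex_esum setT _ (fun s => (t^-1 * s)%g))//.
split=> //; first by move=> x y _ _ /mulgI.
by move=> y _; exists (t * y)%g => //=; rewrite mulKg.
Qed.

Lemma conv_term_le (f g : l1) s x t :
  ((normc (f t x * translate sigma t (g (t^-1 * s)%g) x))%:E <=
   supnorm (f t) * supnorm (g (t^-1 * s)%g))%E.
Proof.
rewrite normcM EFinM; apply: lee_pmul; rewrite ?lee_fin ?normc_ge0//.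
  exact: le_supnorm.
exact: (le_supnorm (g (t^-1 * s)%g)).
Qed.

Lemma conv_term_summable (f g : l1) s :
  (\esum_(t in [set: G]) (supnorm (f t) * supnorm (g (t^-1 * s)%g)) < +oo)%E.
Proof.
apply: le_lt_trans (esum_supnorm_conv f g).
apply: esum_ge; exists [set s]; first by split.
by rewrite fsbig_set1.
Qed.

Lemma translate_continuous (f : l1) s t :
  continuous (translate sigma s (f t) : X -> R[i]^o).
Proof.
move=> x; apply: (@continuous_comp _ _ _ (sigma s^-1%g) (f t : X -> R[i]^o)).
  exact: act_continuous.
exact: l1_continuous.
Qed.

Lemma conv_l1 (f g : l1) : conv f g \in l1_pred.
Proof.
apply/asboolP; split=> [s x0|]; last first.
  apply: le_lt_trans (esum_supnorm_conv f g); apply: le_esum => s _.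
  apply: supnorm_le => [|x].
    by apply: esum_ge0 => t _; rewrite mule_ge0 ?supnorm_ge0.
  apply: le_trans (normc_csum _) _.
    apply: le_lt_trans (conv_term_summable f g s).
    by apply: le_esum => t _; exact: conv_term_le.
  by apply: le_esum => t _; exact: conv_term_le.
pose a x t := f t x * translate sigma t (g (t^-1 * s)%g) x.
have aoo x : (\esum_(t in [set: G]) (normc (a x t))%:E < +oo)%E.
  apply: le_lt_trans (conv_term_summable f g s).
  by apply: le_esum => t _; exact: conv_term_le.
apply/(@cvgcP R X (nbhs x0)) => e e0.
have e30 : 0 < e / 3 by rewrite divr_gt0.
have [F Fe] : exists F : {fset G}, forall x, normc (csum (a x) - fsum (a x) F) < e / 3.
  have [t|F Fe] := esum_small_tail _ (conv_term_summable f g s) e30.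
    by rewrite mule_ge0 ?supnorm_ge0.
  exists F => x; rewrite -lte_fin; apply: le_lt_trans Fe.
  apply: le_trans (csum_tail _ (aoo x)) _.
  by apply: le_esum => t _; exact: conv_term_le.
have : continuous (fun x => fsum (a x) F : R[i]^o).
  move=> x; rewrite /continuous_at/= /fsum.
  elim: (enum_fset F) => [|t r IHr].
    by under eq_fun do rewrite big_nil; rewrite big_nil; exact: cvg_cst.
  under eq_fun do rewrite big_cons; rewrite big_cons.
  apply: cvgD IHr; apply: cvgM; first exact: l1_continuous.
  exact: translate_continuous.
move=> /(_ x0) /(@cvgcP R X (nbhs x0)) /(_ _ e30); apply: filterS => x xe.
have := Fe x0; have := Fe x; rewrite -normcN opprB => h1 h2.
have -> : conv f g s x0 - conv f g s x =
  (csum (a x0) - fsum (a x0) F) + (fsum (a x0) F - fsum (a x) F) +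
  (fsum (a x) F - csum (a x)) by rewrite !addrA !subrK.
rewrite (le_lt_trans (le_normcD _ _))//.
rewrite (_ : e = e / 3 + e / 3 + e / 3); last by field.
by rewrite ltrD// (le_lt_trans (le_normcD _ _))// ltrD.
Qed.

Definition l1_mul (f g : l1) : l1 := L1 (conv_l1 f g).

Lemma star_l1 (f : l1) :
  (fun s => translate sigma s (fun x => (f s^-1%g x)^*)) \in l1_pred.
Proof.
apply/asboolP; split=> [s x|].
  apply/(@cvgcP R X (nbhs x)) => e e0.
  have /(_ x) := @translate_continuous f s s^-1%g.
  move=> /(@cvgcP R X (nbhs x)) /(_ _ e0); apply: filterS => y.
  by rewrite /translate -rmorphB/= normcJ.
apply: le_lt_trans (l1_summable f).
rewrite [leRHS](reindex_esum setT _ (fun s => s^-1%g)).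
  apply: le_esum => s _; apply: le_trans (supnorm_comp _ _) _.
  by rewrite supnormJ.
split=> //; first by move=> s t _ _ /invg_inj.
by move=> s _; exists s^-1%g => //=; rewrite invgK.
Qed.

Definition l1_star (f : l1) : l1 := L1 (star_l1 f).

Record is_ideal (I : set l1) : Prop := {
  ideal0 : I 0;
  idealD : forall f g, I f -> I g -> I (f + g);
  idealZ : forall (c : R[i]) f, I f -> I (c *: f);
  idealMl : forall f g, I g -> I (l1_mul f g);
  idealMr : forall f g, I f -> I (l1_mul f g) }.

Definition self_adjoint (I : set l1) := forall f, I f -> I (l1_star f).

(* C(X), as the elements supported on the identity. *)
Definition l1_CX : set l1 := [set f | forall s, s <> 1%g -> f s = 0].

End l1.

(* Main.v *)
(** (3) => (1).  Let [f] be in a closed nonzero ideal [I].  After translating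
    and rescaling, [f e] takes the value 1 at a point [x0] with trivial stabiliser.
    Cutting [f] down by a bump function [h] supported near [x0] kills finitely
    many prescribed coefficients off the identity, so that [a = h f h] in [I] is
    within 1/2 of [h^2].  If [k h = k], then multiplying [k] repeatedly by
    [b = h^2 - a] changes it only by elements of [I], while [|k b^n| -> 0];
    hence [k] is in [I].  This is Kaplansky's argument that the supremum norm is
    minimal on C(X).

    (2) => (3).  The functions [f] with [sum_(t | t x = y) f t y = 0] for all
    [x], [y] form the kernel of the representation of the crossed product on the
    functions on [X]; it is a closed self-adjoint ideal meeting C(X) only in 0.
    If the action is not topologically free, Baire's theorem provides [s <> e]
    fixing a nonempty open set pointwise, and for [u] supported in that set,
    [u delta_e - u delta_s] is in the kernel. *)
Require Import Defs.
From HB Require Import structures.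
From mathcomp Require Import all_boot all_order all_algebra.
From mathcomp Require Import finmap complex.
From mathcomp Require Import all_classical all_reals all_analysis ring lra.
Set Implicit Arguments.
Unset Strict Implicit.
Unset Printing Implicit Defensive.
Import Order.TTheory GRing.Theory Num.Theory numFieldNormedType.Exports.
Import ComplexField.Normc.
Local Open Scope classical_set_scope.
Local Open Scope ring_scope.

(** * Unordered sums of complex families *)

Section csum_theory.
Context (R : realType) (I : choiceType).
Implicit Types a b : I -> R[i].

Definition csummable a := (\esum_(t in [set: I]) (normc (a t))%:E < +oo)%E.

(** [csum] is a [lim], hence an arbitrary point without convergence; exhibiting a limit settles
    convergence and value at once. *)
Lemma csum_unique a (l : R[i]) :
  (forall e : R, 0 < e ->
    \forall F \near @finsets I, normc (l - fsum a F) < e) ->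
  csum a = l.
Proof.
move=> al; apply: (@cvg_lim (R[i]^o)); first exact: norm_hausdorff.
by apply/(@cvgcP R _ (@finsets I)).
Qed.

Lemma csum_single a i : (forall t, t != i -> a t = 0) -> csum a = a i.
Proof.
move=> a0; apply: csum_unique => e e0; exists [fset i]%fset => // F /= iF.
have {}iF : i \in F by rewrite -fsub1set.
rewrite /fsum (big_fsetD1 i)//= big_seq big1 ?addr0 ?subrr ?normc0// => t.
by rewrite !inE => /andP[ti _]; exact: a0.
Qed.

Lemma csumD a b : csummable a -> csummable b ->
  csum (fun t => a t + b t) = csum a + csum b.
Proof.
move=> /csum_cvgP ac /csum_cvgP bc; apply: csum_unique => e e0.
have e20 : 0 < e / 2 by rewrite divr_gt0.
near=> F; rewrite /fsum big_split/= opprD addrACA [e]splitr.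
by apply: le_lt_trans (le_normcD _ _) _; rewrite ltrD//; near: F;
  [exact: ac|exact: bc].
Unshelve. all: by end_near. Qed.

Lemma csumZ (c : R[i]) a : csummable a -> csum (fun t => c * a t) = c * csum a.
Proof.
move=> /csum_cvgP ac; apply: csum_unique => e e0.
(* The [+ 1] keeps the divisor positive when [c] is zero. *)
have c0 : 0 < normc c + 1 by rewrite ltr_pwDr// normc_ge0.
near=> F; rewrite /fsum -mulr_sumr -mulrBr normcM.
apply: (@le_lt_trans _ _ ((normc c + 1) * normc (csum a - fsum a F))).
  by rewrite ler_wpM2r ?normc_ge0// lerDl.
rewrite mulrC -ltr_pdivlMr//; near: F; apply: ac.
by rewrite divr_gt0.
Unshelve. all: by end_near. Qed.

Lemma csum_conj a : csummable a ->
  csum (fun t => (a t)^*%C) = (csum a)^*%C.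
Proof.
move=> /csum_cvgP ac; apply: csum_unique => e e0.
near=> F; rewrite /fsum -rmorph_sum -rmorphB/= Defs.normcJ.
by near: F; exact: ac.
Unshelve. all: by end_near. Qed.

Lemma csummable_le a (b : I -> \bar R) :
  (forall t, ((normc (a t))%:E <= b t)%E) ->
  (\esum_(t in [set: I]) b t < +oo)%E -> csummable a.
Proof. by move=> ab; apply: le_lt_trans; apply: le_esum => t _; exact: ab. Qed.

Lemma csum_reindex (J : choiceType) a (h : J -> I) (k : I -> J) :
  cancel h k -> cancel k h -> csummable a -> csum (a \o h) = csum a.
Proof.
move=> hk kh /csum_cvgP ac.
apply: (@cvg_lim (R[i]^o)); first exact: norm_hausdorff.
apply/(@cvgcP R _ (@finsets J)) => e e0.
have [F0 _ F0e] := ac e e0.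
(* If [F] contains the image of [F0] under [k], then the image of [F] under [h] contains [F0], and
   both partial sums agree. *)
exists (k @` F0)%fset => // F /= kF.
have -> : fsum (a \o h) F = fsum a (h @` F)%fset.
  by rewrite /fsum big_imfset//= => x y _ _; exact: (can_inj hk).
apply: F0e; apply/fsubsetP => t tF; apply/imfsetP; exists (k t) => //=.
by apply: (fsubsetP kF); exact: in_imfset.
Qed.

End csum_theory.

(** * The Banach algebra: closed sets, elementary elements, products *)

Section l1_theory.
Context (R : realType) (G : groupType) (X : topologicalType).
Implicit Types (f g : l1 R G X) (u : X -> R[i]).

Lemma l1DE f g s x : (f + g) s x = f s x + g s x. Proof. by []. Qed.
Lemma l1NE f s x : (- f) s x = - f s x. Proof. by []. Qed.
Lemma l1ZE c f s x : (c *: f) s x = c * f s x. Proof. by []. Qed.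

Lemma l1_ext f g : (forall s x, f s x = g s x) -> f = g.
Proof.
by move=> fg; apply/val_inj/funext => s; apply/funext => x; exact: fg.
Qed.

Lemma l1_normrE f : `|f| = (l1_norm f)%:C%C.
Proof. by []. Qed.

Lemma l1_norm_ge0 f : 0 <= l1_norm f.
Proof. by rewrite -lee_fin l1_normE esum_ge0// => s _; exact: supnorm_ge0. Qed.

Lemma supnorm_le_l1 f s : (supnorm (f s) <= (l1_norm f)%:E)%E.
Proof.
rewrite l1_normE; apply: esum_ge; exists [set s]; first by split.
by rewrite fsbig_set1.
Qed.

Lemma supnorm_lty f s : (supnorm (f s) < +oo)%E.
Proof. by apply: le_lt_trans (supnorm_le_l1 f s) _; exact: ltry. Qed.

(** Balls have radii in [R[i]], where [0 < e] forces a zero imaginary part; closedness can therefore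
    be tested with real radii. *)
Lemma closed_l1P (I : set (l1 R G X)) : closed I <->
  forall f,
    (forall e : R, 0 < e -> exists2 g, I g & l1_norm (f - g) < e) -> I f.
Proof.
split=> [cI f fI|cI f fI].
  apply: cI => B /nbhs_ballP[[e e']/=]; rewrite ltcE/= => /andP[/eqP-> e0] eB.
  have [g Ig fg] := fI _ e0; exists g; split=> //; apply: eB.
  by rewrite -ball_normE/= l1_normrE ltcR.
apply: cI => e e0.
have [|g [Ig]] := fI (ball f e%:C%C).
  by apply: nbhsx_ballx; rewrite ltcR.
rewrite -ball_normE/= l1_normrE ltcR => fg.
by exists g.
Qed.

(** The elementary element $u\delta_s$ of the crossed product. *)
Definition single_fun u (s : G) : G -> X -> R[i] :=
  fun t => if t == s then u else 0.

Lemma esum_supnorm_single u s :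
  \esum_(t in [set: G]) supnorm (single_fun u s t) = supnorm u.
Proof.
rewrite -(@esum_set1 _ _ s (fun=> supnorm u) (supnorm_ge0 u)).
rewrite [RHS]esum_mkcond; apply: eq_esum => t _.
rewrite /single_fun; case: (eqVneq t s) => [->|ts]; first by rewrite mem_set.
by rewrite memNset ?supnorm0//= => /eqP; rewrite (negPf ts).
Qed.

Lemma single_l1 u s : continuous (u : X -> R[i]^o) -> (supnorm u < +oo)%E ->
  single_fun u s \in @l1_pred R G X.
Proof.
move=> cu uoo; apply/asboolP; split; last by rewrite esum_supnorm_single.
move=> t; rewrite /single_fun.
by case: ifP => _; [exact: cu|exact: cst_continuous].
Qed.

Definition l1_single u s (cu : continuous (u : X -> R[i]^o))
  (uoo : (supnorm u < +oo)%E) : l1 R G X := L1 (single_l1 s cu uoo).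

Lemma l1_singleE u s cu uoo t x :
  @l1_single u s cu uoo t x = if t == s then u x else 0.
Proof. by rewrite /= /single_fun; case: ifP. Qed.

(** The truncations of [f] to finite sets are sums of elementary elements, and their distance to [f]
    is a tail of the convergent series of supremum norms. *)
Lemma l1_induction f (P : set (l1 R G X)) : closed P -> P 0 ->
  (forall g h, P g -> P h -> P (g + h)) ->
  (forall s, P (l1_single s (@l1_continuous _ _ _ f s) (supnorm_lty f s))) ->
  P f.
Proof.
move=> /closed_l1P cP P0 PD Psingle; apply: cP => e e0.
have [s|F Fe] := esum_small_tail _ (l1_summable f) e0; first exact: supnorm_ge0.
pose g := \sum_(s <- F) l1_single s (@l1_continuous _ _ _ f s) (supnorm_lty f s).
have gE t x : g t x = if t \in F then f t x else 0.
  rewrite /g (big_morph (fun h : l1 R G X => h t x) (id1 := 0) (op1 := +%R))//.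
  have [tF|tF] := boolP (t \in F).
    rewrite (bigD1_seq t) ?fset_uniq//= big1 => [|s st].
      by rewrite addr0 /single_fun eqxx.
    by rewrite /single_fun eq_sym (negPf st).
  rewrite big1_seq// => s /andP[_ sF]; rewrite l1_singleE ifN//.
  by apply: contraNN tF => /eqP ->.
exists g; first by apply: big_ind.
rewrite -lte_fin l1_normE; apply: le_lt_trans Fe.
rewrite [leRHS]esum_mkcond; apply: le_esum => t _.
apply: supnorm_le; first by case: ifP => // _; exact: supnorm_ge0.
move=> x; rewrite l1DE l1NE gE; case: (boolP (t \in F)) => tF.
  by rewrite subrr normc0; case: ifP => // _; exact: supnorm_ge0.
by rewrite subr0 mem_set ?le_supnorm//; apply/negP.
Qed.

Context (sigma : action G X).

Lemma csummable_conv f g s x :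
  csummable (fun t => f t x * translate sigma t (g (t^-1 * s)%g) x).
Proof.
by apply: csummable_le (conv_term_summable f g s) => t; exact: conv_term_le.
Qed.

Lemma l1_mulE f g s x : l1_mul sigma f g s x =
  csum (fun t => f t x * g (t^-1 * s)%g (sigma t^-1%g x)).
Proof. by []. Qed.

Lemma l1_mulDl f g h :
  l1_mul sigma (f + g) h = l1_mul sigma f h + l1_mul sigma g h.
Proof.
apply: l1_ext => s x; rewrite l1DE !l1_mulE -csumD; try exact: csummable_conv.
by congr csum; apply/funext => t; rewrite l1DE mulrDl.
Qed.

Lemma l1_mulDr f g h :
  l1_mul sigma f (g + h) = l1_mul sigma f g + l1_mul sigma f h.
Proof.
apply: l1_ext => s x; rewrite l1DE !l1_mulE -csumD; try exact: csummable_conv.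
by congr csum; apply/funext => t; rewrite l1DE mulrDr.
Qed.

Lemma l1_mul_singlel u s cu uoo f r x :
  l1_mul sigma (@l1_single u s cu uoo) f r x =
  u x * f (s^-1 * r)%g (sigma s^-1%g x).
Proof.
rewrite l1_mulE (@csum_single _ _ _ s) ?l1_singleE ?eqxx// => t ts.
by rewrite l1_singleE (negPf ts) mul0r.
Qed.

Lemma l1_mul_singler u s cu uoo f r x :
  l1_mul sigma f (@l1_single u s cu uoo) r x =
  f (r * s^-1)%g x * u (sigma (s * r^-1)%g x).
Proof.
rewrite l1_mulE (@csum_single _ _ _ (r * s^-1)%g).
  by rewrite l1_singleE invgM invgK mulgVK eqxx.
move=> t ts; rewrite l1_singleE ifN ?mulr0//; apply: contra ts => /eqP <-.
by rewrite invgM invgK mulVKg.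
Qed.

(** By Tonelli the sum over [s] may be taken first; the substitution of $t^{-1}s$ for [s] then turns
    it into the norm of [g], independently of [t]. *)
Lemma l1_norm_mul f g : l1_norm (l1_mul sigma f g) <= l1_norm f * l1_norm g.
Proof.
have N0 (h : l1 R G X) t : (0 <= supnorm (h t))%E by exact: supnorm_ge0.
have fg0 s t : (0 <= supnorm (f t) * supnorm (g (t^-1 * s)%g))%E.
  by rewrite mule_ge0.
rewrite -lee_fin l1_normE.
apply: (@le_trans _ _ (\esum_(s in [set: G]) \esum_(t in [set: G])
     (supnorm (f t) * supnorm (g (t^-1 * s)%g)))%E).
  apply: le_esum => s _; apply: supnorm_le => [|x].
    by apply: esum_ge0 => t _.
  apply: le_trans (normc_csum (csummable_conv f g s x)) _.
  by apply: le_esum => t _; exact: conv_term_le.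
rewrite esum_esum//.
rewrite (reindex_esum ([set: G] `*`` (fun=> [set: G])) _
  (fun x => (x.2, x.1)))/=; last first.
  split=> //; first by move=> [x1 x2] [y1 y2] _ _ [-> ->].
  by move=> [x y] _; exists (y, x).
rewrite -(@esum_esum _ _ _ _ (fun=> setT)
  (fun t s => supnorm (f t) * supnorm (g (t^-1 * s)%g)))%E//.
rewrite EFinM muleC (l1_normE f) -esumZl ?l1_norm_ge0//.
apply: le_esum => t _.
rewrite -(fineK (_ : supnorm (f t) \is a fin_num)) ?ge0_fin_numE ?supnorm_lty//.
rewrite esumZl ?fine_ge0//.
rewrite [leRHS]muleC l1_normE lee_wpmul2l ?lee_fin ?fine_ge0//.
rewrite [leRHS](reindex_esum setT _ (fun s => (t^-1 * s)%g))//.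
split=> //; first by move=> x y _ _ /mulgI.
by move=> y _; exists (t * y)%g => //=; rewrite mulKg.
Qed.

Lemma l1_mul0l f : l1_mul sigma 0 f = 0.
Proof. by apply: (addrI (l1_mul sigma 0 f)); rewrite -l1_mulDl !addr0. Qed.

Lemma l1_mul0r f : l1_mul sigma f 0 = 0.
Proof. by apply: (addrI (l1_mul sigma f 0)); rewrite -l1_mulDr !addr0. Qed.

(** Right multiplication by [g] is Lipschitz, so the preimage of a closed set is closed. *)
Lemma closed_l1_mull (I : set (l1 R G X)) g : closed I ->
  closed [set f | I (l1_mul sigma f g)].
Proof.
move=> /closed_l1P cI; apply/closed_l1P => f fI; apply: cI => e e0.
have g0 : 0 < l1_norm g + 1 by rewrite ltr_pwDr// l1_norm_ge0.
have [|h Ih fh] := fI (e / (l1_norm g + 1)); first by rewrite divr_gt0.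
exists (l1_mul sigma h g) => //.
have -> : l1_mul sigma f g - l1_mul sigma h g = l1_mul sigma (f - h) g.
  by apply/eqP; rewrite subr_eq -l1_mulDl subrK.
apply: le_lt_trans (l1_norm_mul _ _) _.
apply: (@le_lt_trans _ _ (l1_norm (f - h) * (l1_norm g + 1))).
  by rewrite ler_wpM2l ?l1_norm_ge0// lerDl.
by rewrite -ltr_pdivlMr.
Qed.

Lemma closed_l1_mulr (I : set (l1 R G X)) g : closed I ->
  closed [set f | I (l1_mul sigma g f)].
Proof.
move=> /closed_l1P cI; apply/closed_l1P => f fI; apply: cI => e e0.
have g0 : 0 < l1_norm g + 1 by rewrite ltr_pwDr// l1_norm_ge0.
have [|h Ih fh] := fI (e / (l1_norm g + 1)); first by rewrite divr_gt0.
exists (l1_mul sigma g h) => //.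
have -> : l1_mul sigma g f - l1_mul sigma g h = l1_mul sigma g (f - h).
  by apply/eqP; rewrite subr_eq -l1_mulDr subrK.
apply: le_lt_trans (l1_norm_mul _ _) _.
apply: (@le_lt_trans _ _ ((l1_norm g + 1) * l1_norm (f - h))).
  by rewrite ler_wpM2r ?l1_norm_ge0// lerDl.
by rewrite mulrC -ltr_pdivlMr.
Qed.

End l1_theory.

(** * Baire category and cutoff functions on compact Hausdorff spaces *)

Section topology.
Context (X : topologicalType) (X_compact : compact [set: X])
  (X_hausdorff : hausdorff_space X).

(** Otherwise every nonempty open set has a point outside [F n], and regularity shrinks it to a
    nonempty open set whose closure avoids [F n]. Iterating from [O] gives a nested sequence, and
    compactness a point of [O] outside all [F n]. *)
Lemma compact_hausdorff_baire (F : nat -> set X) (O : set X) :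
  (forall n, closed (F n)) -> open O -> O !=set0 -> O `<=` \bigcup_n F n ->
  exists n U, [/\ open U, U !=set0 & U `<=` F n].
Proof.
move=> Fcl Oop O0 OF; apply: contrapT => noU.
have /choice[g gP] : forall nU : nat * set X, exists V : set X,
    open nU.2 -> nU.2 !=set0 ->
    [/\ open V, V !=set0 & closure V `<=` nU.2 `\` F nU.1].
  move=> -[n U] /=; apply: contrapT => noV.
  (* The choice function must be total; for [U] not open or empty the requirement is vacuous, and
     [setT] serves. *)
  have oU : open U by apply: contrapT => oU; apply: noV; exists setT.
  have U0 : U !=set0 by apply: contrapT => U0; apply: noV; exists setT.
  have [x [Ux Fx]] : U `\` F n !=set0.
    apply/set0P/negP => /eqP; rewrite setD_eq0 => UF.
    by apply: noU; exists n, U.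
  have UFx : nbhs x (U `\` F n).
    apply: open_nbhs_nbhs; split=> //; apply: openI => //.
    exact: closed_openC.
  have [B xB BUF] := compact_regular X_hausdorff X_compact filterT UFx.
  apply: noV; exists B° => _ _; split; first exact: open_interior.
    by exists x.
  by apply: subset_trans BUF; apply: closureS; exact: interior_subset.
pose V := fix V n := if n is m.+1 then g (m, V m) else O.
have VP n : open (V n) /\ V n !=set0.
  elim: n => // n [oV V0] /=.
  by have [] := gP (n, V n) oV V0.
have VS n : closure (V n.+1) `<=` V n `\` F n.
  by have [oV V0] := VP n; have [] := gP (n, V n) oV V0.
have Vle m n : (m <= n)%N -> V n `<=` V m.
  elim: n => [|n IH]; first by rewrite leqn0 => /eqP ->.
  rewrite leq_eqVlt => /predU1P[->//|/IH]; apply: subset_trans.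
  move=> x /subset_closure/VS; by case.
have /choice[p pV] : forall n, exists x, V n x by move=> n; exact: (VP n).2.
(* A cluster point of [p] lies in the closure of every [V n.+1], because the sequence eventually
   stays in [V n.+1]. *)
have [z [_]] := X_compact (fmap_proper_filter p eventually_filter) filterT.
rewrite clusterE => zc.
have zV n : (V n `\` F n) z.
  apply: VS; apply: zc; exists n.+1 => // m /= nm.
  exact: Vle nm _ (pV m).
have [n _ Fz] := OF z (zV 0).1.
by have [_ /(_ Fz)] := zV n.
Qed.

Context (R : realType).

Lemma urysohn_bump (x0 : X) (U : set X) : nbhs x0 U ->
  exists h : X -> R, [/\ continuous h, forall x, 0 <= h x <= 1,
    h x0 = 1 & forall x, ~ U x -> h x = 0].
Proof.
move=> xU.
have /(@normal_separatorP R) sep := compact_normal X_hausdorff X_compact.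
have /(@uniform_separatorP X R)[h [hc h01 h0 h1]] :
    uniform_separator (~` U°) [set x0].
  apply: sep; first exact/open_closedC/open_interior.
    exact/accessible_closed_set1/hausdorff_accessible.
  by rewrite -subset0 => x /= [xnU xx0]; apply: xnU; rewrite xx0.
exists h; split=> //.
- by move=> x; have := h01 (h x); rewrite /= in_itv/=; apply; exists x.
- by apply: h1; exists x0.
- by move=> x Ux; apply: h0; exists x => // /interior_subset.
Qed.

Lemma continuous_realc (h : X -> R) : continuous h ->
  continuous (fun x => (h x)%:C%C : R[i]^o).
Proof.
move=> hc x; apply/(@cvgcP R X (nbhs x)) => e e0.
have /cvgrPdist_lt/(_ e e0) := hc x; apply: filterS => y.
by rewrite -rmorphB/= expr0n/= addr0 sqrtr_sqr.
Qed.

Lemma supnorm_le1 (h : X -> R) : (forall x, 0 <= h x <= 1) ->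
  (supnorm (fun x => (h x)%:C%C) <= 1)%E.
Proof.
move=> h01; apply: supnorm_le => // x.
rewrite lee_fin /= expr0n/= addr0 sqrtr_sqr.
by have /andP[h0 h1] := h01 x; rewrite ger0_norm.
Qed.

End topology.

(** * Displaced points and fixed-point sets *)

Section displaced.
Context (G : groupType) (X : topologicalType) (sigma : action G X)
  (X_hausdorff : hausdorff_space X).

Lemma displaced_nbhs s x : sigma s x <> x ->
  exists2 U, nbhs x U & forall y, U y -> ~ U (sigma s y).
Proof.
move=> sx; move: (X_hausdorff); rewrite open_hausdorff => /(_ (sigma s x) x).
case; first exact/eqP.
move=> [A B] /= [/set_mem Asx /set_mem Bx] [oA oB /eqP AB].
exists (sigma s @^-1` A `&` B).
  apply: filterI; last exact: open_nbhs_nbhs.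
  by apply: act_continuous; exact: open_nbhs_nbhs.
move=> y [Ay _] [_ By]; suff : (A `&` B) (sigma s y) by rewrite AB.
by split.
Qed.

Lemma closed_fixed_points s : closed [set x | sigma s x = x].
Proof.
rewrite -[X in closed X]setCK; apply: open_closedC.
rewrite openE => x /= /displaced_nbhs[U xU sU].
by apply: filterS xU => y Uy /= sy; apply: (sU y Uy); rewrite sy.
Qed.

End displaced.

(** * The representation on functions on the space, and its kernel *)

Section orbit_kernel.
Context (R : realType) (G : groupType) (X : topologicalType)
  (sigma : action G X).
Implicit Types (f g : l1 R G X) (x y : X).

(** The matrix coefficient at $e_y$ of $f e_x$, where $\delta_t$ sends the point mass $e_x$ to
    $e_{tx}$ and C(X) acts by multiplication. *)
Definition orbit_coef f x y : R[i] :=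
  csum (fun t => if `[< sigma t x = y >] then f t y else 0).

Lemma csummable_orbit f x y :
  csummable (fun t => if `[< sigma t x = y >] then f t y else 0).
Proof.
apply: csummable_le (l1_summable f) => t.
case: ifP => _; first exact: le_supnorm.
by rewrite normc0 supnorm_ge0.
Qed.

Lemma orbit_coefD f g x y :
  orbit_coef (f + g) x y = orbit_coef f x y + orbit_coef g x y.
Proof.
rewrite /orbit_coef -csumD; try exact: csummable_orbit.
by congr csum; apply/funext => t; case: ifP => // _; rewrite addr0.
Qed.

Lemma orbit_coefZ (c : R[i]) f x y :
  orbit_coef (c *: f) x y = c * orbit_coef f x y.
Proof.
rewrite /orbit_coef -csumZ; last exact: csummable_orbit.
by congr csum; apply/funext => t; case: ifP => // _; rewrite mulr0.
Qed.

Lemma orbit_coefB f g x y :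
  orbit_coef (f - g) x y = orbit_coef f x y - orbit_coef g x y.
Proof. by rewrite -scaleN1r orbit_coefD orbit_coefZ mulN1r. Qed.

Lemma normc_orbit_coef f x y : normc (orbit_coef f x y) <= l1_norm f.
Proof.
rewrite -lee_fin l1_normE.
apply: le_trans (normc_csum (csummable_orbit f x y)) _.
apply: le_esum => t _; case: ifP => _; first exact: le_supnorm.
by rewrite normc0 supnorm_ge0.
Qed.

Lemma orbit_coef_single u s cu uoo x y :
  orbit_coef (@l1_single R G X u s cu uoo) x y =
  if `[< sigma s x = y >] then u y else 0.
Proof.
rewrite /orbit_coef (@csum_single _ _ _ s) ?l1_singleE ?eqxx// => t ts.
by rewrite l1_singleE (negPf ts); case: ifP.
Qed.

(** Multiplicativity of the representation when the left factor is elementary; the next lemma treats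
    an elementary right factor. This is the form that [l1_induction] calls for. *)
Lemma orbit_coef_singlel u s cu uoo f x y :
  orbit_coef (l1_mul sigma (@l1_single R G X u s cu uoo) f) x y =
  u y * orbit_coef f x (sigma s^-1%g y).
Proof.
rewrite /orbit_coef -csumZ; last exact: csummable_orbit.
rewrite -(@csum_reindex _ _ _ _ (fun r => s * r)%g (fun r => s^-1 * r)%g);
  [|exact: mulKg|exact: mulVKg|exact: csummable_orbit].
congr csum; apply/funext => t; rewrite /comp l1_mul_singlel mulKg actM.
have -> : `[< sigma s (sigma t x) = y >] = `[< sigma t x = sigma s^-1%g y >].
  by apply: asbool_equiv_eq; split=> [<-|->]; rewrite -actM ?mulVg ?mulgV act1.
by case: ifP => //; rewrite mulr0.
Qed.

Lemma orbit_coef_singler u s cu uoo f x y :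
  orbit_coef (l1_mul sigma f (@l1_single R G X u s cu uoo)) x y =
  u (sigma s x) * orbit_coef f (sigma s x) y.
Proof.
rewrite /orbit_coef -csumZ; last exact: csummable_orbit.
rewrite -(@csum_reindex _ _ _ _ (fun r => r * s)%g (fun r => r * s^-1)%g);
  [|exact: mulgK|exact: mulgVK|exact: csummable_orbit].
congr csum; apply/funext => t; rewrite /comp l1_mul_singler mulgK.
rewrite invgM mulVKg actM mulrC.
case: ifP => [/asboolP <-|_]; last by rewrite mulr0.
by rewrite -actM mulVg act1.
Qed.

(** The involution becomes the adjoint matrix: inverting the summation index exchanges the
    conditions $t^{-1}x=y$ and $ty=x$. *)
Lemma orbit_coef_star f x y :
  orbit_coef (l1_star sigma f) x y = (orbit_coef f y x)^*%C.
Proof.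
rewrite /orbit_coef -csum_conj; last exact: csummable_orbit.
rewrite -(@csum_reindex _ _ _ _ (fun r => r^-1)%g (fun r => r^-1)%g);
  [|exact: invgK|exact: invgK|exact: csummable_orbit].
congr csum; apply/funext => t; rewrite /comp /= /translate !invgK.
have -> : `[< sigma t^-1%g x = y >] = `[< sigma t y = x >].
  by apply: asbool_equiv_eq; split=> <-; rewrite -actM ?mulVg ?mulgV act1.
by case: ifP => [/asboolP ->//|_]; rewrite conjc0.
Qed.

Definition orbit_kernel : set (l1 R G X) :=
  [set f | forall x y, orbit_coef f x y = 0].

Lemma closed_orbit_kernel : closed orbit_kernel.
Proof.
apply/closed_l1P => f fI x y; apply: eq0_normc; apply/eqP.
rewrite eq_le normc_ge0 andbT; apply/ler_addgt0Pr => e /fI[g gI fg].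
rewrite add0r -[orbit_coef f x y]subr0 -(gI x y) -orbit_coefB.
exact: le_trans (normc_orbit_coef _ _ _) (ltW fg).
Qed.

Lemma orbit_kernel0 : orbit_kernel 0.
Proof. by move=> x y; rewrite -(scale0r 0) orbit_coefZ mul0r. Qed.

Lemma orbit_kernelD f g :
  orbit_kernel f -> orbit_kernel g -> orbit_kernel (f + g).
Proof. by move=> fI gI x y; rewrite orbit_coefD fI gI addr0. Qed.

(** The multipliers that carry a fixed kernel element into the kernel form a closed set stable under
    addition, so elementary multipliers suffice. *)
Lemma orbit_kernel_ideal : is_ideal sigma orbit_kernel.
Proof.
split.
- exact: orbit_kernel0.
- exact: orbit_kernelD.
- by move=> c f fI x y; rewrite orbit_coefZ fI mulr0.
- move=> f g gI.
  apply: (@l1_induction _ _ _ f [set f | orbit_kernel (l1_mul sigma f g)]).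
  + by apply: closed_l1_mull; exact: closed_orbit_kernel.
  + by rewrite /= l1_mul0l; exact: orbit_kernel0.
  + by move=> h k /= hI kI; rewrite l1_mulDl; exact: orbit_kernelD.
  + by move=> s x y; rewrite orbit_coef_singlel gI mulr0.
- move=> f g fI.
  apply: (@l1_induction _ _ _ g [set g | orbit_kernel (l1_mul sigma f g)]).
  + by apply: closed_l1_mulr; exact: closed_orbit_kernel.
  + by rewrite /= l1_mul0r; exact: orbit_kernel0.
  + by move=> h k /= hI kI; rewrite l1_mulDr; exact: orbit_kernelD.
  + by move=> s x y; rewrite orbit_coef_singler fI mulr0.
Qed.

Lemma orbit_kernel_self_adjoint : self_adjoint sigma orbit_kernel.
Proof. by move=> f fI x y; rewrite orbit_coef_star fI conjc0. Qed.

(** For [f] supported on the identity, the diagonal coefficient at [x] is the value of [f 1] at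
    [x]. *)
Lemma orbit_kernel_CX : orbit_kernel `&` @l1_CX R G X = [set 0].
Proof.
apply/seteqP; split=> [f [fI fCX]|_ ->]; last first.
  by split=> //; exact: orbit_kernel0.
apply: l1_ext => s x; have [->|s1] := eqVneq s 1%g; last first.
  by rewrite fCX//; exact/eqP.
rewrite -[RHS](fI x x) /orbit_coef (@csum_single _ _ _ 1%g).
  by rewrite ifT//; apply/asboolP; rewrite act1.
by move=> t t1; rewrite fCX; [case: ifP|exact/eqP].
Qed.

End orbit_kernel.

(** * From a trivial kernel to topological freeness *)

Lemma orbit_kernel_trivial_free (R : realType) (G : groupType)
    (X : topologicalType)
    (sigma : action G X) :
  countable [set: G] -> compact [set: X] -> hausdorff_space X ->
  orbit_kernel sigma = [set (0 : l1 R G X)] -> topologically_free sigma.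
Proof.
move=> /countable_injP[num numI] X_compact X_hausdorff I0 O O0 Oop.
apply: contrapT => Ofree.
(* As [num] is injective, [F n] is the fixed-point set of the nontrivial element with code [n], or
   empty if there is none. *)
pose F n := [set x | exists2 s, num s = n & s <> 1%g /\ sigma s x = x].
have Fcl n : closed (F n).
  have [[s [sn s1]]|ns] := pselect (exists s, num s = n /\ s <> 1%g);
    last first.
    rewrite (_ : F n = set0) -?subset0; first exact: closed0.
    by move=> x [s sn [s1 _]]; apply: ns; exists s.
  have -> : F n = [set x | sigma s x = x].
    apply/seteqP; split=> [x [t tn [t1 tx]] /=|x sx]; last by exists s.
    by rewrite (numI s t) ?inE ?sn.
  exact: closed_fixed_points.
have [|n [U [Uop [x0 Ux0] UF]]] :=
    compact_hausdorff_baire X_compact X_hausdorff Fcl Oop O0.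
  move=> x Ox; apply: contrapT => nx; apply: Ofree.
  exists x; split=> // s s1 sx.
  by apply: nx; exists (num s) => //; exists s.
have [s sn [s1 _]] := UF _ Ux0.
have Us y : U y -> sigma s y = y.
  by move=> /UF[t tn [_ ty]]; rewrite (numI s t) ?inE ?sn.
have [h [hc h01 hx0 hU]] :=
  urysohn_bump X_compact X_hausdorff R (open_nbhs_nbhs (conj Uop Ux0)).
have uc := continuous_realc hc.
have uoo : (supnorm (fun x => (h x)%:C%C) < +oo)%E.
  by apply: le_lt_trans (supnorm_le1 h01) _; exact: ltry.
pose f : l1 R G X := l1_single 1%g uc uoo - l1_single s uc uoo.
have : orbit_kernel sigma f.
  move=> x y; rewrite orbit_coefB !orbit_coef_single act1.
  (* Outside [U] both coefficients vanish with [h]; for [y] in [U], which [s] fixes, $sx=y$ amounts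
     to $x=y$, and the two terms cancel. *)
  have [Uy|nUy] := pselect (U y); last by rewrite hU// !if_same subrr.
  have -> : `[< sigma s x = y >] = `[< x = y >].
    apply: asbool_equiv_eq; split=> [sx|->]; last exact: Us.
    rewrite -(act1 sigma x) -(mulVg s) actM sx -[in LHS](Us y Uy).
    by rewrite -actM mulVg act1.
  by rewrite subrr.
rewrite I0 => f0.
have : f 1%g x0 = 0 by rewrite f0.
rewrite l1DE l1NE !l1_singleE eqxx ifN ?subr0 ?hx0; last first.
  by rewrite eq_sym; exact/eqP.
by move/eqP; rewrite oner_eq0.
Qed.

(** From a bump [g], take $h=\min(1,2g)$ and $k=\max(0,2g-1)$: where [k] is nonzero, $2g>1$ and
    hence $h=1$. *)
Lemma cutoff_pair (R : realType) (X : topologicalType) :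
  compact [set: X] -> hausdorff_space X ->
  forall (x0 : X) (U : set X), nbhs x0 U -> exists h k : X -> R,
  [/\ continuous h /\ continuous k,
      (forall x, 0 <= h x <= 1) /\ (forall x, 0 <= k x <= 1),
      forall x, ~ U x -> h x = 0,
      k x0 = 1 & forall x, k x * h x = k x].
Proof.
move=> X_compact X_hausdorff x0 U xU.
have [g [gc g01 g1 gU]] := urysohn_bump X_compact X_hausdorff R xU.
have g2c : continuous (fun x => 2 * g x).
  by move=> x; apply: cvgM; [exact: cvg_cst|exact: gc].
exists (fun x => Num.min 1 (2 * g x)), (fun x => Num.max 0 (2 * g x - 1)).
split.
- split=> x.
    by apply: (@continuous_min R X (cst 1) (fun x => 2 * g x) x);
      [exact: cst_continuous|exact: g2c].
  apply: (@continuous_max R X (cst 0) (fun x => 2 * g x - 1) x).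
    exact: cst_continuous.
  by apply: cvgB; [exact: g2c|exact: cvg_cst].
- split=> x; have /andP[g0 g1'] := g01 x.
    by rewrite le_min ler01 mulr_ge0//= ge_min lexx.
  by rewrite le_max lexx ge_max ler01/=; lra.
- by move=> x /gU ->; rewrite mulr0; rewrite min_r.
- by rewrite g1 max_r; lra.
- move=> x; have [gx|gx] := leP (2 * g x) 1.
    by rewrite max_l ?mul0r//; lra.
  by rewrite mulr1.
Qed.

(** * Closed ideals over a topologically free action *)

Section free_ideal.
Context (R : realType) (G : groupType) (X : topologicalType)
  (sigma : action G X).
Context (X_compact : compact [set: X]) (X_hausdorff : hausdorff_space X).

Lemma displaced_nbhs_seq (r : seq G) (x : X) :
  (forall s, s <> 1%g -> sigma s x <> x) ->
  exists2 U, nbhs x U &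
    forall s, s \in r -> s <> 1%g -> forall y, U y -> ~ U (sigma s y).
Proof.
move=> xfree; elim: r => [|t r [U xU Ur]].
  by exists setT; [exact: filterT|].
have [->|t1] := eqVneq t 1%g.
  exists U => // s; rewrite inE => /predU1P[->//|]; exact: Ur.
have [V xV Vt] := displaced_nbhs X_hausdorff (xfree t (elimN eqP t1)).
exists (U `&` V); first exact: filterI.
move=> s; rewrite inE => /predU1P[->|sr] s1 y [Uy Vy] [Us Vs].
  exact: Vt Vs.
exact: Ur Us.
Qed.

Context (I : set (l1 R G X)) (I_ideal : is_ideal sigma I) (I_closed : closed I).

Lemma ideal_free_point : topologically_free sigma -> I <> [set 0] ->
  exists f x, [/\ I f, f 1%g x = 1 & forall s, s <> 1%g -> sigma s x <> x].
Proof.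
move=> sigma_free I_neq0.
have [f [s [y [If fsy]]]] : exists f s y, I f /\ f s y <> 0.
  apply: contrapT => f0; apply: I_neq0; apply/seteqP; split=> [f If|_ ->].
    apply: l1_ext => s y; apply: contrapT => fsy.
    by apply: f0; exists f, s, y.
  exact: (Defs.ideal0 I_ideal).
have oneC : continuous ((fun=> 1) : X -> R[i]^o) by exact: cst_continuous.
have oneoo : (supnorm ((fun=> 1%R) : X -> R[i]) < +oo)%E.
  apply: (@le_lt_trans _ _ 1%E); last exact: ltry.
  by apply: supnorm_le => // x; rewrite normc1.
(* Right multiplication by $\delta_{s^{-1}}$ moves the coefficient at [s] to the identity without
   changing its values. *)
have [g Ig g1] : exists2 g, I g & forall x, g 1%g x = f s x.
  exists (l1_mul sigma f (l1_single s^-1%g oneC oneoo)).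
    exact: (Defs.idealMr I_ideal).
  by move=> x; rewrite l1_mul_singler invgK mul1g mulr1.
have [x [gx xfree]] : [set x | g 1%g x <> 0] `&`
    [set x | forall s, s <> 1%g -> sigma s x <> x] !=set0.
  apply: sigma_free; first by exists y; rewrite /= g1.
  rewrite openE => x /= /eqP gx.
  have /(@cvgcP R X (nbhs x)) := @l1_continuous _ _ _ g 1%g x.
  (* With the modulus at [x] as radius, nearby values cannot be zero; so the nonvanishing set is
     open and meets the dense set of free points. *)
  move=> /(_ (normc (g 1%g x))) gnear.
  have : 0 < normc (g 1%g x).
    rewrite lt_neqAle normc_ge0 andbT eq_sym.
    by apply: contraNN gx => /eqP/eq0_normc ->.
  move=> /gnear; apply: filterS => z gxz /= gz.
  by move: gxz; rewrite gz subr0 ltxx.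
exists ((g 1%g x)^-1 *: g), x; split=> //.
  exact: (Defs.idealZ I_ideal).
by rewrite l1ZE mulVf//; exact/eqP.
Qed.

(* The last clause says that [h^2 delta_e] is within [1/2] of [a]. *)
Lemma near_cutoff_ideal f x0 : I f -> f 1%g x0 = 1 ->
  (forall s, s <> 1%g -> sigma s x0 <> x0) ->
  exists h k : X -> R,
  [/\ continuous h /\ continuous k,
      (forall x, 0 <= h x <= 1) /\ (forall x, 0 <= k x <= 1),
      k x0 = 1, forall x, k x * h x = k x &
      exists2 a, I a & forall b : l1 R G X,
        (forall r x,
          b r x = (if r == 1%g then (h x * h x)%:C%C else 0) - a r x) ->
        l1_norm b <= 2^-1].
Proof.
move=> If fx0 xfree.
have e4 : 0 < 4^-1 :> R by rewrite invr_gt0.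
have [s|F Fe] := esum_small_tail _ (l1_summable f) e4; first exact: supnorm_ge0.
have [U xU UF] := displaced_nbhs_seq F xfree.
have xV : nbhs x0 (U `&` [set y | normc (1 - f 1%g y) < 4^-1]).
  apply: filterI => //.
  have /(@cvgcP R X (nbhs x0)) := @l1_continuous _ _ _ f 1%g x0.
  by move=> /(_ _ e4); rewrite fx0.
have [h [k [[hc kc] [h01 k01] hV kx0 kh]]] :=
  cutoff_pair R X_compact X_hausdorff xV.
exists h, k; split=> //.
have hoo : (supnorm (fun x => (h x)%:C%C) < +oo)%E.
  by apply: le_lt_trans (supnorm_le1 h01) _; exact: ltry.
pose H : l1 R G X := l1_single 1%g (continuous_realc hc) hoo.
pose a := l1_mul sigma H (l1_mul sigma f H).
have aE r x : a r x = (h x)%:C%C * (f r x * (h (sigma r^-1%g x))%:C%C).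
  by rewrite /a l1_mul_singlel invg1 mul1g act1 l1_mul_singler invg1 mulg1 mul1g.
exists a.
  by apply: (Defs.idealMl I_ideal); exact: (Defs.idealMr I_ideal).
move=> b bE; rewrite -lee_fin l1_normE.
have hn x : normc (h x)%:C%C <= 1.
  rewrite /= expr0n/= addr0 sqrtr_sqr.
  by have /andP[h0 h1] := h01 x; rewrite ger0_norm.
(* The bound 1/2 splits into 1/4 at the identity, where [f 1] is close to 1 on the support of [h],
   and 1/4 for the tail outside [F]. Nontrivial [r] in [F] contribute nothing. *)
pose c1 (r : G) : \bar R := if r \in [set 1%g] then (4^-1)%:E else 0%E.
pose c2 (r : G) : \bar R := if r \in ~` [set` F] then supnorm (f r) else 0%E.
apply: (@le_trans _ _ (\esum_(r in [set: G]) (c1 r + c2 r))%E).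
  have c10 r : (0 <= c1 r)%E by rewrite /c1; case: ifP => // _; rewrite lee_fin ltW.
  have c20 r : (0 <= c2 r)%E by rewrite /c2; case: ifP => // _; exact: supnorm_ge0.
  apply: le_esum => r _; apply: supnorm_le => [|x]; first exact: adde_ge0.
  rewrite bE aE; have [->|r1] := eqVneq r 1%g.
    rewrite invg1 act1; apply: (@le_trans _ _ (c1 1%g)); last exact: leeDl.
    rewrite /c1 mem_set// lee_fin.
    rewrite [X in normc X](_ : _ =
      (h x)%:C%C * (h x)%:C%C * (1 - f 1%g x)); last first.
      by rewrite rmorphM; ring.
    have [[_ fx]|nV] := pselect ((U `&` [set y | normc (1 - f 1%g y) < 4^-1]) x).
      rewrite !normcM -[leRHS]mul1r ler_pM ?mulr_ge0 ?normc_ge0//; last exact: ltW.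
      by rewrite -[leRHS]mul1r ler_pM ?normc_ge0.
    by rewrite hV// !mul0r normc0 ltW.
  apply: (@le_trans _ _ (c2 r)); last exact: leeDr.
  rewrite /c2; have [rF|rF] := boolP (r \in F); last first.
    rewrite mem_set; last exact/negP.
    apply: le_trans (le_supnorm (f r) x); rewrite lee_fin sub0r normcN !normcM.
    rewrite -[leRHS]mul1r ler_pM ?mulr_ge0 ?normc_ge0//.
    by rewrite -[leRHS]mulr1 ler_pM ?normc_ge0.
  rewrite memNset; last by move=> /(_ rF).
  suff -> : (h x)%:C%C * (f r x * (h (sigma r^-1%g x))%:C%C) = 0.
    by rewrite subrr normc0.
  (* The points [x] and $r^{-1}x$ cannot both lie in [U], which [r] displaces; so one of the two
     factors [h] vanishes. *)
  have [[Ux _]|nV] := pselect ((U `&` [set y | normc (1 - f 1%g y) < 4^-1]) x);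
    last by rewrite hV// mul0r.
  rewrite [h (sigma _ _)]hV ?mulr0// => -[Ux' _].
  apply: (UF r rF (elimN eqP r1) _ Ux').
  by rewrite -actM mulgV act1.
rewrite esumD; last 2 first.
- by move=> r _; rewrite /c1; case: ifP => // _; rewrite lee_fin ltW.
- by move=> r _; rewrite /c2; case: ifP => // _; exact: supnorm_ge0.
rewrite -[X in (X + _)%E]esum_mkcond -[X in (_ + X)%E]esum_mkcond.
rewrite esum_set1; last by rewrite lee_fin ltW.
rewrite (_ : (2^-1)%:E = (4^-1)%:E + (4^-1)%:E)%E; last first.
  by rewrite -EFinD; congr EFin; lra.
by rewrite leeD2l// ltW.
Qed.

Lemma free_ideal_CX : topologically_free sigma -> I <> [set 0] ->
  I `&` @l1_CX R G X <> [set 0].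
Proof.
move=> sigma_free I_neq0 ICX.
have [f [x0 [If fx0 xfree]]] := ideal_free_point sigma_free I_neq0.
have [h [k [[hc kc] [h01 k01] kx0 kh [a Ia ab]]]] :=
  near_cutoff_ideal If fx0 xfree.
have h2c : continuous (fun x => h x * h x).
  by move=> x; apply: cvgM; exact: hc.
have h201 x : 0 <= h x * h x <= 1.
  have /andP[h0 h1] := h01 x; rewrite mulr_ge0//=.
  by rewrite -[leRHS]mul1r ler_pM.
have realoo (u : X -> R) : (forall x, 0 <= u x <= 1) ->
    (supnorm (fun x => (u x)%:C%C) < +oo)%E.
  by move=> u01; apply: le_lt_trans (supnorm_le1 u01) _; exact: ltry.
pose K : l1 R G X := l1_single 1%g (continuous_realc kc) (realoo _ k01).
pose b : l1 R G X := l1_single 1%g (continuous_realc h2c) (realoo _ h201) - a.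
have bE r x : b r x = (if r == 1%g then (h x * h x)%:C%C else 0) - a r x.
  by rewrite /b l1DE l1NE l1_singleE.
have b2 : l1_norm b <= 2^-1 by apply: ab.
(* From $kh=k$ follows $kh^2=k$, so the cutoff part of [b] fixes [K] and only the term with [a]
   remains. *)
have Kb : l1_mul sigma K b - K = - 1 *: l1_mul sigma K a.
  apply: l1_ext => r x; rewrite l1DE l1NE l1ZE !l1_mul_singlel invg1 mul1g act1.
  rewrite bE l1_singleE; case: ifP => _; last by rewrite sub0r subr0 mulrN mulN1r.
  by rewrite mulrBr -rmorphM mulrA !kh addrAC subrr sub0r mulN1r.
pose c n := iter n (fun g => l1_mul sigma g b) K.
have Ic n : I (c n - K).
  elim: n => [|n IHn]; first by rewrite subrr; exact: (Defs.ideal0 I_ideal).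
  have -> : c n.+1 - K = l1_mul sigma (c n - K) b + (- 1 *: l1_mul sigma K a).
    by rewrite -Kb addrA -l1_mulDl subrK.
  apply: (Defs.idealD I_ideal) => //; first exact: (Defs.idealMr I_ideal).
  by apply: (Defs.idealZ I_ideal) => //; exact: (Defs.idealMl I_ideal).
have c2 n : l1_norm (c n) <= l1_norm K * 2^-1 ^+ n.
  elim: n => [|n IHn]; first by rewrite expr0 mulr1.
  apply: le_trans (l1_norm_mul _ _ _) _.
  by rewrite exprSr mulrA ler_pM ?l1_norm_ge0.
have IK : I K.
  move/closed_l1P : I_closed; apply=> e e0.
  have : (fun n => l1_norm K * 2^-1 ^+ n) @ \oo --> 0.
    by apply: cvg_geometric; rewrite gtr0_norm; lra.
  move=> /cvgrPdist_lt/(_ e e0)[n _ /(_ n (leqnn n))]; rewrite sub0r normrN => ne.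
  (* The element $K-c_n$ of [I] lies at distance $\|c_n\|$ from [K], which tends to 0. *)
  exists (-1 *: (c n - K)); first exact: (Defs.idealZ I_ideal).
  rewrite scaleN1r opprK addrC subrK.
  by apply: le_lt_trans (c2 n) _; apply: le_lt_trans ne; exact: ler_norm.
have : (I `&` @l1_CX R G X) K.
  by split=> // s /eqP s1; apply/funext => x; rewrite /K l1_singleE (negPf s1).
rewrite ICX => K0; have : K 1%g x0 = 0 by rewrite K0.
by rewrite l1_singleE eqxx kx0 => /eqP; rewrite oner_eq0.
Qed.

End free_ideal.

Theorem theorem2 (R : realType) (G : groupType) (X : topologicalType)
    (sigma : action G X)
    (G_countable : countable [set: G]) (G_infinite : infinite_set [set: G])
    (X_compact : compact [set: X]) (X_hausdorff : hausdorff_space X) :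
  let P1 := forall I : set (l1 R G X),
    is_ideal sigma I -> closed I -> I <> [set 0] ->
    I `&` @l1_CX R G X <> [set 0] in
  let P2 := forall I : set (l1 R G X),
    is_ideal sigma I -> closed I -> self_adjoint sigma I -> I <> [set 0] ->
    I `&` @l1_CX R G X <> [set 0] in
  let P3 := topologically_free sigma in
  (P1 <-> P2) /\ (P2 <-> P3).
Proof.
move=> P1 P2 P3.
have P12 : P1 -> P2 by move=> p1 I I_ideal I_closed _; exact: p1.
have P23 : P2 -> P3.
  move=> p2; apply: (@orbit_kernel_trivial_free R) => //.
  (* A nonzero kernel would contradict [p2], because it meets C(X) only in 0. *)
  apply: contrapT => I0; apply: (p2 (orbit_kernel sigma)) => //.
  - exact: orbit_kernel_ideal.
  - exact: closed_orbit_kernel.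
  - exact: orbit_kernel_self_adjoint.
  - exact: orbit_kernel_CX.
have P31 : P3 -> P1.
  move=> p3 I I_ideal I_closed I0.
  exact: (free_ideal_CX X_compact X_hausdorff I_ideal I_closed p3 I0).
by split; split=> // ?; [exact: P31 (P23 _)|exact: P12 (P31 _)].
Qed.
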